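(* Let $J\subset\mathbb R$ be an interval, let $A$ be a continuous real $n\times n$ matrix function on $J$, and let $G$ be a multiplicative group of real continuously differentiable on $J$ nonsingular matrices of order $n$. Suppose the system $\dfrac{dx}{dt}=A(t)x$ is reducible to the system with constant coefficients $\dfrac{dy}{dt}=By$ by a transformation matrix $\mathrm g\in G$, and let $C=B^{T}$. Let $\lambda$ be an eigenvalue of $C$ with an elementary divisor of multiplicity $m\geq2$, corresponding to a real eigenvector $\nu^{0}$ and to real generalized eigenvectors $\nu^{k}$ of order $k$, $k=1,\dots,m-1$. Let $\Lambda$ be any domain contained in $\{(t,x)\colon t\in J,\ \nu^{0}\mathrm g(t)x\neq0\}\subset J\times\mathbb R^n$, and let the functions $\Psi_\tau\colon\Lambda\to\mathbb R$, $\tau=1,\dots,m-1$, be the solution of the functional system $$\nu^{k}\mathrm g(t)x=\sum_{\tau=1}^{k}\binom{k-1}{\tau-1}\Psi_\tau(t,x)\,\nu^{k-\tau}\mathrm g(t)x\quad\text{for all }(t,x)\in\Lambda,\quad k=1,\dots,m-1.$$ Then the functions $$F_\xi\colon(t,x)\mapsto\Psi_\xi(t,x)\quad\text{for all }(t,x)\in\Lambda,\quad\xi=2,\dots,m-1,$$ are functionally independent first integrals of the system $\dfrac{dx}{dt}=A(t)x$.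
   Context: A domain is an open arcwise connected set. Vectors $\nu$ act as rows in $\nu\,\mathrm g(t)x$ (i.e. $\nu y=\sum_\xi\nu_\xi y_\xi$ with $y=\mathrm g(t)x$) and as columns when multiplied by $C$. If $C\nu^{0}=\lambda\nu^{0}$, $\nu^0\ne0$, non-zero vectors $\nu^{k}$ are called generalized eigenvectors of order $k$ if $(C-\lambda E)\nu^{k}=k\,\nu^{k-1}$, $k=1,\dots,m-1$, $E$ the identity matrix. The system $dx/dt=A(t)x$ is reducible to $dy/dt=By$ ($B$ a real constant $n\times n$ matrix) by $\mathrm g\in G$ if the substitution $y=\mathrm g(t)x$ transforms the first system into the second; in particular $\dfrac{d\,\mathrm g(t)}{dt}=B\,\mathrm g(t)-\mathrm g(t)A(t)$ for all $t\in J$. A first integral of $dx/dt=X(t,x)$ on a domain $G'$ is a continuously differentiable function $F\colon G'\to\mathbb R$ with $\partial_tF(t,x)+\sum_{\xi=1}^nX_\xi(t,x)\,\partial_{x_\xi}F(t,x)=0$ for all $(t,x)\in G'$. *)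

(* Defs.v *)
From HB Require Import structures.
From mathcomp Require Import all_boot all_order all_algebra.
From mathcomp Require Import all_classical all_reals all_analysis.

Set Implicit Arguments.
Unset Strict Implicit.
Unset Printing Implicit Defensive.

Import Order.TTheory GRing.Theory Num.Theory.
Import numFieldNormedType.Exports.

Local Open Scope classical_set_scope.
Local Open Scope ring_scope.

(* Difference quotients are restricted to increments that stay in [J], so the
   derivative is one-sided at an endpoint belonging to [J]. *)
Definition is_derive_on (R : realType) (V : normedModType R)
    (J : set R) (f : R -> V) (t : R) (l : V) : Prop :=
  (fun h : R => h^-1 *: (f (t + h) - f t))
    @ (within [set h | J (t + h)] (0 : R)^') --> l.

Definition cont_diff_on (R : realType) (V : normedModType R)
    (J : set R) (f : R -> V) : Prop :=
  exists2 f' : R -> V,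
    (forall t, J t -> is_derive_on J f t (f' t)) & {within J, continuous f'}.

(* Functions on [J] are represented by total functions whose values outside [J]
   are irrelevant: the group operations are required only up to equality on
   [J]. *)
Definition matrix_fun_group (R : realType) (n : nat) (J : set R)
    (G : set (R -> 'M[R]_n)) : Prop :=
  [/\ forall g, G g ->
        cont_diff_on J g /\ (forall t, J t -> g t \in unitmx),
      exists2 e, G e & forall t, J t -> e t = 1%:M,
      forall g h, G g -> G h ->
        exists2 k, G k & forall t, J t -> k t = g t *m h t
    & forall g, G g ->
        exists2 k, G k & forall t, J t -> k t = invmx (g t)].

Definition ode_solution (R : realType) (n : nat) (J : set R)
    (A : R -> 'M[R]_n) (x : R -> 'cV[R]_n) : Prop :=
  forall t, J t -> is_derive_on J x t (A t *m x t).

(* The substitution y = g(t) x transforms dx/dt = A(t) x into dy/dt = B y: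
   solutions correspond to solutions.  The second conjunct is the resulting
   equation g' + g A = B g between the coefficients. *)
Definition reduces (R : realType) (n : nat) (J : set R)
    (A : R -> 'M[R]_n) (B : 'M[R]_n) (g : R -> 'M[R]_n) : Prop :=
  (forall x : R -> 'cV[R]_n,
     ode_solution J A x <-> ode_solution J (fun=> B) (fun t => g t *m x t))
  /\ (forall t, J t -> is_derive_on J g t (B *m g t - g t *m A t)).

(* D_k: the gcd of the k x k minors of 'X - C.  Row and column selections that
   are not increasing only repeat minors up to sign or contribute 0. *)
Definition det_divisor (F : fieldType) (n : nat) (C : 'M[F]_n) (k : nat)
    : {poly F} :=
  \big[@gcdp F/0]_(fg : {ffun 'I_k -> 'I_n} * {ffun 'I_k -> 'I_n})
    \det (mxsub fg.1 fg.2 (char_poly_mx C)).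

(* ('X - lam) ^+ m is an elementary divisor of C: it is the exact power of
   'X - lam in one of the invariant polynomials D_{k+1} / D_k. *)
Definition elementary_divisor (F : fieldType) (n : nat) (C : 'M[F]_n)
    (lam : F) (m : nat) : Prop :=
  (0 < m)%N /\
  exists2 k, (k < n)%N & mup lam (det_divisor C k.+1 %/ det_divisor C k) = m.

(* A column vector [nu] acting as a row: nu y = \sum_i nu_i y_i. *)
Definition row_act (R : realType) (n : nat) (nu y : 'cV[R]_n) : R :=
  \sum_(i < n) nu i 0 * y i 0.

Definition arcwise_connected (R : realType) (T : topologicalType)
    (D : set T) : Prop :=
  forall p q, D p -> D q ->
    exists gamma : R -> T,
      [/\ {within `[0, 1], continuous gamma}, gamma 0 = p, gamma 1 = q
        & forall s, s \in `[0, 1] -> D (gamma s)].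

Definition is_domain (R : realType) (n : nat) (D : set (R * 'cV[R]_n)) : Prop :=
  open D /\ arcwise_connected R D.

Definition cont_diff (R : realType) (n : nat) (D : set (R * 'cV[R]_n))
    (F : R * 'cV[R]_n -> R) : Prop :=
  (forall p, D p -> differentiable F p) /\
  (forall v p, D p -> {for p, continuous (fun q => 'D_v F q)}).

Definition partial_t (R : realType) (n : nat) (F : R * 'cV[R]_n -> R)
    (p : R * 'cV[R]_n) : R :=
  'D_((1 : R), (0 : 'cV[R]_n)) F p.

Definition partial_x (R : realType) (n : nat) (i : 'I_n)
    (F : R * 'cV[R]_n -> R) (p : R * 'cV[R]_n) : R :=
  'D_((0 : R), (delta_mx i 0 : 'cV[R]_n)) F p.

Definition first_integral (R : realType) (n : nat)
    (X : R -> 'cV[R]_n -> 'cV[R]_n) (D : set (R * 'cV[R]_n))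
    (F : R * 'cV[R]_n -> R) : Prop :=
  cont_diff D F /\
  forall t x, D (t, x) ->
    partial_t F (t, x) + \sum_(i < n) X t x i 0 * partial_x i F (t, x) = 0.

Definition jacobian_tx (R : realType) (n k : nat)
    (F : 'I_k -> R * 'cV[R]_n -> R) (p : R * 'cV[R]_n) : 'M[R]_(k, 1 + n) :=
  row_mx (\col_(i < k) partial_t (F i) p)
         (\matrix_(i < k, j < n) partial_x j (F i) p).

(* Independence is required at every point of [D], not merely outside a null
   set. *)
Definition functionally_independent (R : realType) (n k : nat)
    (D : set (R * 'cV[R]_n)) (F : 'I_k -> R * 'cV[R]_n -> R) : Prop :=
  forall p, D p -> \rank (jacobian_tx F p) = k.

(* Main.v *)
(* Write u_k = nu^k g(t) x and let D be the derivation along (1, A(t) x).  From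
   g' = B g - g A one gets D u_k = lam u_k + k u_{k-1}.  The functional system
   says, in exponential generating functions, that
   sum_k u_k s^k / k! = u_0 exp (sum_tau Psi_tau s^tau / tau!); applying D shows
   D Psi_1 = 1 and D Psi_k = 0 for k >= 2.  For independence, the nu^k form a
   Jordan chain, so their rows times g(t) have a right inverse, whose columns z_j
   satisfy d u_k (0, z_j) = delta_{kj}; the matrix of the d Psi_k (0, z_j) is
   then triangular with diagonal entries 1 / u_0. *)
Require Import Defs.
From HB Require Import structures.
From mathcomp Require Import all_boot all_order all_algebra.
From mathcomp Require Import all_classical all_reals all_analysis.
From mathcomp Require Import ring.
Set Implicit Arguments.
Unset Strict Implicit.
Unset Printing Implicit Defensive.
Import Order.TTheory GRing.Theory Num.Theory.
Import numFieldNormedType.Exports.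
Local Open Scope classical_set_scope.
Local Open Scope ring_scope.

(** * Algebra of the binomial system and of the Jordan chain *)

(** Here [d] is any derivation acting on the chain as the flow does. Putting the recurrence for [du]
    into the differentiated system cancels all terms in [P] and leaves $\sum_\tau \binom{k}{\tau-1}
    dP_\tau u_{k+1-\tau} = u_k$. This is triangular with diagonal $u_0 \neq 0$, and $dP = (1, 0, 0,
    \dots)$ solves it. *)
Lemma derivation_values (F : fieldType) (m : nat) (lam : F) (u du P dP : nat -> F) :
  u 0%N != 0 ->
  (forall k, (k < m)%N -> du k = lam * u k + k%:R * u k.-1) ->
  (forall k, (1 <= k < m)%N -> u k =
     \sum_(1 <= tau < k.+1) 'C(k.-1, tau.-1)%:R * P tau * u (k - tau)%N) ->
  (forall k, (1 <= k < m)%N -> du k =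
     \sum_(1 <= tau < k.+1) 'C(k.-1, tau.-1)%:R *
       (P tau * du (k - tau)%N + dP tau * u (k - tau)%N)) ->
  forall k, (1 <= k < m)%N -> dP k = (k == 1%N)%:R.
Proof.
move=> u0 hdu hu hP k; elim/ltn_ind: k => -[//|k] IH /= km.
have := hP k.+1 km; rewrite (hdu _ km) (hu k.+1 km) /=.
have eqD : \sum_(1 <= tau < k.+2) 'C(k, tau.-1)%:R *
       (P tau * du (k.+1 - tau)%N + dP tau * u (k.+1 - tau)%N) =
   lam * (\sum_(1 <= tau < k.+2) 'C(k, tau.-1)%:R * P tau * u (k.+1 - tau)%N)
   + k%:R * u k
   + \sum_(1 <= tau < k.+2) 'C(k, tau.-1)%:R * dP tau * u (k.+1 - tau)%N.
  have -> : k%:R * u k = \sum_(1 <= tau < k.+2) 'C(k, tau.-1)%:R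
      * P tau * (k.+1 - tau)%:R * u (k - tau)%N.
    (* The term [tau = k.+1] has the factor 0, so the truncated index [k - tau] is harmless there.
       The others are the system at [k], by $(k+1-\tau)\binom{k}{\tau-1} = k\binom{k-1}{\tau-1}$. *)
    rewrite big_nat_recr //= subnn !(mulr0, mul0r) addr0.
    case: k km {IH} => [|k] km; first by rewrite mul0r big_geq.
    rewrite (hu k.+1) ?(ltnW km) // mulr_sumr.
    apply: eq_big_nat => -[//|t] /andP[_ tk] /=.
    rewrite !subSS !mulrA; congr (_ * _).
    by rewrite [RHS]mulrAC -!natrM [in RHS]mulnC mul_bin_down.
  rewrite mulr_sumr -!big_split; apply: eq_big_nat => t /andP[t1 tk] /=.
  have tm : (k.+1 - t < m)%N by exact: leq_ltn_trans (leq_subr _ _) km.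
  rewrite hdu //.
  have -> : (k.+1 - t).-1 = (k - t)%N by rewrite -subnS subSS.
  by ring.
rewrite eqD -addrA => /addrI.
have -> : k.+1%:R * u k = k%:R * u k + u k by rewrite -natr1 mulrDl mul1r.
move/addrI; rewrite /= big_nat_recr //= subnn binn mul1r.
case: k km IH {hP eqD} => [|k] km IH.
  rewrite big_geq // add0r => /eqP; rewrite -[X in X == _]mul1r => /eqP.
  by move/(mulIf u0).
(* The term [tau = 1] already equals the right-hand side and those strictly between vanish by
   induction, so [dP k.+2 * u 0 = 0] remains. *)
rewrite big_nat_recl //= bin0 mul1r IH //; last by rewrite (leq_ltn_trans _ km).
rewrite mul1r subSS subn0 -addrA -[X in X = _]addr0 => /addrI.
rewrite big1_seq ?add0r.
  by move/esym/eqP; rewrite mulf_eq0 (negPf u0) orbF => /eqP ->.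
move=> t; rewrite mem_index_iota => /andP[_ /andP[t1 tk]].
by rewrite (IH t.+1 tk (@ltn_trans k.+2 t.+1 m tk km)) eqSS gtn_eqF // mulr0 mul0r.
Qed.

(** Now [d] is differentiation in a direction that annihilates the chain below index [j]. In the
    equation for $du_k$ with $k \le j$, every term with $\tau < k$ vanishes: $dP_\tau$ by induction,
    and $du_{k-\tau}$ because $k-\tau < j$. What survives is $du_k = dP_k u_0$. *)
Lemma triangular_values (F : fieldType) (m j : nat) (u du P dP : nat -> F) :
  u 0%N != 0 -> (0 < j)%N ->
  (forall k, (k < j)%N -> du k = 0) -> du j = 1 ->
  (forall k, (1 <= k < m)%N -> du k =
     \sum_(1 <= tau < k.+1) 'C(k.-1, tau.-1)%:R *
       (P tau * du (k - tau)%N + dP tau * u (k - tau)%N)) ->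
  forall k, (1 <= k < m)%N -> (k <= j)%N -> dP k = (k == j)%:R / u 0%N.
Proof.
move=> u0 j0 hdu hduj hP k; elim/ltn_ind: k => -[//|k] IH /= km kj.
have := hP k.+1 km; rewrite /= big_nat_recr //= subnn binn mul1r (hdu 0%N) //.
rewrite mulr0 add0r big1_seq ?add0r.
  have -> : du k.+1 = (k.+1 == j)%:R.
    by move: kj; rewrite leq_eqVlt; case: eqVneq => [->//|_ /= /hdu].
  by move->; rewrite mulfK.
move=> t; rewrite mem_index_iota => /andP[_ /andP[t1 tk]].
have tm : (t < m)%N by exact: ltn_trans tk km.
have tj : (t < j)%N by exact: leq_trans tk kj.
rewrite IH ?t1 ?(ltnW tj) //= ltn_eqF // mul0r mul0r addr0 hdu ?mulr0 //.
by rewrite (leq_trans _ kj) // ltn_subrL t1.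
Qed.

(** $C - \lambda E$ lowers the chain with factor $k$, so its powers bring out falling factorials. In
    a relation with top index $k$, the $k$-th power isolates $\nu^0$ with the factor $k!$, nonzero
    in characteristic zero. *)
Lemma chain_row_free (F : numFieldType) (n m : nat) (C : 'M[F]_n) (lam : F)
    (nu : nat -> 'cV[F]_n) :
  nu 0%N != 0 -> C *m nu 0%N = lam *: nu 0%N ->
  (forall k : nat, (1 <= k < m)%N -> (C - lam%:M) *m nu k = k%:R *: nu k.-1) ->
  row_free (\matrix_(k < m) (nu k)^T).
Proof.
move=> nu0 Cnu0 hnu.
pose D := C - lam%:M.
have D0 : D *m nu 0%N = 0 by rewrite mulmxBl Cnu0 mul_scalar_mx subrr.
have iterD i k : (k < m)%N ->
    iter i (mulmx D) (nu k) = if (i <= k)%N then (k ^_ i)%:R *: nu (k - i)%N else 0.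
  move=> km; elim: i => [|i IH]; first by rewrite subn0 ffactn0 scale1r.
  rewrite iterS IH; case: (ltngtP i k) => [ik|ik|->].
  - rewrite -scalemxAr hnu; last by rewrite subn_gt0 ik (leq_ltn_trans (leq_subr _ _)).
    by rewrite scalerA -natrM -ffactnSr subnS.
  - by rewrite mulmx0.
  - by rewrite -scalemxAr subnn D0 scaler0.
apply/inj_row_free => c hc.
have hsum : \sum_(k < m) c 0 k *: nu k = 0.
  rewrite -[RHS](trmx0 _ 1) -hc mulmx_sum_row linear_sum /=.
  by apply: eq_bigr => k _; rewrite linearZ /= rowK trmxK.
apply/rowP => i; rewrite mxE; apply/eqP/negPn/negP => ci.
case: (@arg_maxnP _ i (fun k => c 0 k != 0) (fun k => k : nat) ci) => k ck kmax.
have iterlin q (f : 'I_m -> 'cV[F]_n) :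
    iter q (mulmx D) (\sum_l f l) = \sum_l iter q (mulmx D) (f l).
  by elim: q => //= q ->; rewrite mulmx_sumr.
have iterZ q a (v : 'cV[F]_n) :
    iter q (mulmx D) (a *: v) = a *: iter q (mulmx D) v.
  by elim: q => //= q ->; rewrite -scalemxAr.
have iter0 q : iter q (mulmx D) 0 = 0 :> 'cV[F]_n.
  by elim: q => //= q ->; rewrite mulmx0.
(* [k] is the largest index in the relation, so [D ^ k] leaves only [c_k k! nu_0]. *)
have := congr1 (iter k (mulmx D)) hsum.
rewrite iter0 iterlin (bigD1 k) //= big1 ?addr0.
  rewrite iterZ iterD // leqnn subnn ffactnn => /eqP; rewrite !scaler_eq0 (negPf ck).
  by rewrite (negPf nu0) pnatr_eq0 -leqn0 leqNgt fact_gt0.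
move=> l lk; rewrite iterZ iterD //; case: (leqP k l) => [kl|]; last by rewrite scaler0.
have [->|/kmax /= ] := eqVneq (c 0 l) 0; first by rewrite scale0r.
by rewrite leqNgt ltn_neqAle kl eq_sym -val_eqE /= in lk * => /negP[]; rewrite lk.
Qed.

(** * Continuously differentiable functions on an open set *)

(** The difference [g - f] vanishes near [a], hence is $o(h)$ and has differential 0; then [g] is
    the sum of two differentiable functions. *)
Lemma near_eq_differentiable (R : numFieldType) (V W : normedModType R)
    (f g : V -> W) (a : V) :
  {near a, f =1 g} -> differentiable f a -> differentiable g a.
Proof.
move=> fg df.
pose k := g - f.
have k0 : k a = 0 by rewrite /k !fctE (nbhs_singleton fg) subrr.
have fg0 : \forall h \near 0, f (h + a) = g (h + a).
  by move: fg; rewrite /= (near_shift 0 a) /= subr0.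
have ok : k \o shift a = cst (k a) + (0 : V -> W) +o_ 0 id.
  apply/eqaddoP => e e0; near=> h.
  rewrite /= !fctE /= k0 !addr0 subr0 /k !fctE.
  suff -> : f (h + a) = g (h + a) by rewrite subrr normr0 mulr_ge0 // ltW.
  by near: h.
have dk : 'd k a = (0 : V -> W) :> (V -> W).
  by apply: diff_unique => //; exact: cst_continuous.
have : differentiable k a.
  by apply/diff_locallyP; rewrite dk; split => //; exact: cst_continuous.
move/(differentiableD df); suff -> : f + k = g by [].
by rewrite /k addrC subrK.
Unshelve. all: by end_near. Qed.

Lemma fst_continuous (T U : topologicalType) : continuous (@fst T U).
Proof. by move=> x; exact: cvg_fst. Qed.

Lemma snd_continuous (T U : topologicalType) : continuous (@snd T U).
Proof. by move=> x; exact: cvg_snd. Qed.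

Lemma differentiable_fst (R : numFieldType) (V W : normedModType R) (p : V * W) :
  differentiable (@fst V W) p.
Proof. apply: linear_differentiable; exact: fst_continuous. Qed.

Lemma differentiable_snd (R : numFieldType) (V W : normedModType R) (p : V * W) :
  differentiable (@snd V W) p.
Proof. apply: linear_differentiable; exact: snd_continuous. Qed.

(** At an interior point of [J] all small increments stay in [J], so the restricted limit is the
    ordinary one; taking an entry is continuous. *)
Lemma is_derive_on_coord (R : realType) (n : nat) (J : set R) (f : R -> 'M[R]_n)
    (t : R) (l : 'M[R]_n) (i j : 'I_n) :
  nbhs t J -> is_derive_on J f t l -> is_derive t 1 (fun s => f s i j) (l i j).
Proof.
move=> Jt fl.
have : (fun h : R => h^-1 *: (f (h *: 1 + t) i j - f t i j)) @ (0 : R)^' --> l i j.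
  have Jh : \forall h \near (0 : R)^', J (t + h).
    apply: cvg_within; have : \near t, J t by []; rewrite (near_shift 0 t) /= subr0.
    by apply: filterS => h; rewrite /= addrC.
  have := cvg_comp _ _ fl (@coord_continuous _ _ _ i j l).
  move=> H P /H HP.
  have {}HP : \forall h \near (0 : R)^',
      J (t + h) -> P ((h^-1 *: (f (t + h) - f t)) i j) by exact: HP.
  apply: filterS2 HP Jh => h /= Hh Jth.
  by have := Hh Jth; rewrite /= !mxE /GRing.scale /= mulr1 (addrC t).
by move=> hl; apply: DeriveDef; [apply/cvg_ex; exists (l i j)|apply/cvg_lim].
Unshelve. all: by end_near. Qed.

Lemma near_eq_continuous (T U : topologicalType) (f g : T -> U) (x : T) :
  {near x, f =1 g} -> {for x, continuous f} -> {for x, continuous g}.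
Proof.
move=> fg fx; rewrite /prop_for /continuous_at -(nbhs_singleton fg).
exact: cvg_trans (near_eq_cvg fg) fx.
Qed.

(** Continuity at [p] depends only on values near [p], so on an open [D] a formula for the
    derivatives valid just on [D] suffices. The closure properties below each supply such a
    formula. *)
Lemma cont_diff_from_derive (R : realType) (n : nat) (D : set (R * 'cV[R]_n))
    (F : R * 'cV[R]_n -> R) (dF : R * 'cV[R]_n -> R * 'cV[R]_n -> R) :
  open D -> (forall p, D p -> differentiable F p) ->
  (forall v p, D p -> 'D_v F p = dF v p) ->
  (forall v p, D p -> {for p, continuous (dF v)}) -> cont_diff D F.
Proof.
move=> oD diffF dFE cdF; split=> // v p Dp.
apply: near_eq_continuous (cdF v p Dp).
have Dnear : nbhs p D by exact: open_nbhs_nbhs.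
by apply: filterS Dnear => q Dq; rewrite dFE.
Qed.

Lemma cont_diff_eq (R : realType) (n : nat) (D : set (R * 'cV[R]_n))
    (F G : R * 'cV[R]_n -> R) :
  open D -> (forall p, D p -> F p = G p) -> cont_diff D F -> cont_diff D G.
Proof.
move=> oD FG [dF cF].
have FGnear p : D p -> {near p, F =1 G}.
  by move=> Dp; apply: filterS (open_nbhs_nbhs (conj oD Dp)) => q /FG.
apply: (cont_diff_from_derive (dF := fun v p => 'D_v F p)) => //.
- by move=> p Dp; apply: near_eq_differentiable (dF p Dp); exact: FGnear.
- by move=> v p Dp; apply/esym/near_eq_derive; exact: FGnear.
Qed.

Lemma cont_diff_continuous (R : realType) (n : nat) (D : set (R * 'cV[R]_n))
    (F : R * 'cV[R]_n -> R) p :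
  cont_diff D F -> D p -> {for p, continuous F}.
Proof. by move=> [dF _] Dp; apply: differentiable_continuous; exact: dF. Qed.

Lemma cont_diff_cst (R : realType) (n : nat) (D : set (R * 'cV[R]_n)) (c : R) :
  cont_diff D (fun=> c).
Proof.
split=> [p _|v p _]; first exact: differentiable_cst.
rewrite (_ : (fun q => 'D_v _ q) = cst 0); last by apply/funext => q; exact: derive_cst.
exact: cst_continuous.
Qed.

Lemma cont_diffD (R : realType) (n : nat) (D : set (R * 'cV[R]_n))
    (F G : R * 'cV[R]_n -> R) :
  open D -> cont_diff D F -> cont_diff D G -> cont_diff D (F + G).
Proof.
move=> oD [dF cF] [dG cG].
apply: (cont_diff_from_derive (dF := fun v p => 'D_v F p + 'D_v G p)) => //.
- by move=> p Dp; apply: differentiableD; [exact: dF|exact: dG].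
- by move=> v p Dp; apply: deriveD; apply: diff_derivable; [exact: dF|exact: dG].
- by move=> v p Dp; apply: cvgD; [exact: cF|exact: cG].
Qed.

Lemma cont_diffM (R : realType) (n : nat) (D : set (R * 'cV[R]_n))
    (F G : R * 'cV[R]_n -> R) :
  open D -> cont_diff D F -> cont_diff D G -> cont_diff D (F * G).
Proof.
move=> oD cdF cdG; have [[dF cF] [dG cG]] := (cdF, cdG).
apply: (cont_diff_from_derive (dF := fun v p => F p * 'D_v G p + G p * 'D_v F p)) => //.
- by move=> p Dp; apply: differentiableM; [exact: dF|exact: dG].
- by move=> v p Dp; apply: deriveM; apply: diff_derivable; [exact: dF|exact: dG].
- move=> v p Dp; apply: cvgD; apply: cvgM.
  + exact: cont_diff_continuous cdF Dp.
  + exact: cG.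
  + exact: cont_diff_continuous cdG Dp.
  + exact: cF.
Qed.

Lemma cont_diffV (R : realType) (n : nat) (D : set (R * 'cV[R]_n))
    (F : R * 'cV[R]_n -> R) :
  open D -> (forall p, D p -> F p != 0) -> cont_diff D F ->
  cont_diff D (fun p => (F p)^-1).
Proof.
move=> oD F0 cdF; have [dF cF] := cdF.
have cont_inv p : D p -> {for p, continuous (fun q => (F q)^-1)}.
  by move=> Dp; apply: cvgV; [exact: F0|exact: cont_diff_continuous cdF Dp].
apply: (cont_diff_from_derive (dF := fun v p => - ((F p)^-1 * (F p)^-1) * 'D_v F p)) => //.
- by move=> p Dp; apply: differentiableV; [exact: dF|exact: F0].
- move=> v p Dp; rewrite deriveV; last by apply: diff_derivable; exact: dF.
    by rewrite expr2 invfM.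
  exact: F0.
- move=> v p Dp; apply: cvgM; last exact: cF.
  by apply: cvgN; apply: cvgM; exact: cont_inv.
Qed.

Lemma cont_diff_sum (R : realType) (n : nat) (D : set (R * 'cV[R]_n))
    (I : eqType) (r : seq I) (F : I -> R * 'cV[R]_n -> R) :
  open D -> (forall i, i \in r -> cont_diff D (F i)) ->
  cont_diff D (fun p => \sum_(i <- r) F i p).
Proof.
move=> oD; elim: r => [_|i r IH hF].
  by under eq_fun do rewrite big_nil; exact: cont_diff_cst.
under eq_fun do rewrite big_cons; apply: cont_diffD => //.
- by apply: hF; exact: mem_head.
- by apply: IH => j jr; apply: hF; rewrite inE jr orbT.
Qed.

Lemma derive_big_sum (R : numFieldType) (V : normedModType R)
    (I : eqType) (r : seq I) (F : I -> V -> R) (p v : V) :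
  (forall i, i \in r -> differentiable (F i) p) ->
  differentiable (fun q => \sum_(i <- r) F i q) p /\
  'D_v (fun q => \sum_(i <- r) F i q) p = \sum_(i <- r) 'D_v (F i) p.
Proof.
elim: r => [_|i r IH hF].
  under eq_fun do rewrite big_nil.
  by rewrite derive_cst big_nil; split => //; exact: differentiable_cst.
have [|dS DS] := IH; first by move=> j jr; apply: hF; rewrite inE jr orbT.
have dFi := hF i (mem_head _ _).
under eq_fun do rewrite big_cons.
split; first exact: differentiableD.
by rewrite big_cons -DS; apply: deriveD; exact: diff_derivable.
Qed.

(** * Derivatives of the linear forms [row_act nu (g t *m x)] *)

Lemma snd_coord_derive (R : realType) (n : nat) (j : 'I_n) (p v : R * 'cV[R]_n) :
  differentiable (fun q : R * 'cV[R]_n => q.2 j 0) p /\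
  'D_v (fun q : R * 'cV[R]_n => q.2 j 0) p = v.2 j 0.
Proof.
have dq : differentiable (fun q : R * 'cV[R]_n => q.2 j 0) p.
  exact: (differentiable_comp (differentiable_snd p) (differentiable_coord _ _ _)).
split=> //; apply/cvg_lim => //; apply: cvg_near_cst; near=> h.
rewrite /= !mxE /GRing.scale /= addrK mulKf //.
by near: h; exact: nbhs_dnbhs_neq.
Unshelve. all: by end_near. Qed.

Lemma cont_diff_snd_coord (R : realType) (n : nat) (D : set (R * 'cV[R]_n))
    (j : 'I_n) : open D -> cont_diff D (fun p => p.2 j 0).
Proof.
move=> oD; apply: (cont_diff_from_derive (dF := fun v _ => v.2 j 0)) => //.
- by move=> p _; case: (snd_coord_derive j p 0).
- by move=> v p _; case: (snd_coord_derive j p v).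
- by move=> v p _; exact: cst_continuous.
Qed.

Lemma derive_comp_fst (R : realType) (V : normedModType R) (f : R -> R) (l : R)
    (p v : R * V) :
  is_derive p.1 1 f l ->
  differentiable (fun q : R * V => f q.1) p /\
  'D_v (fun q : R * V => f q.1) p = v.1 * l.
Proof.
move=> [df <-]; have df' : differentiable f p.1 by exact/derivable1_diffP.
have dq : differentiable (f \o fst) p.
  exact: (differentiable_comp (differentiable_fst p)).
split=> //; rewrite deriveE // diff_comp //; last exact: differentiable_fst.
rewrite /= diff_lin; last exact: fst_continuous.
by rewrite deriv1E ?derive1E.
Qed.

(** An open set contains a product neighbourhood of each of its points. Thus times occurring in the
    domain are interior to [J], and one-sided derivatives at endpoints never arise. *)
Lemma open_projection_nbhs (R : realType) (n : nat) (D : set (R * 'cV[R]_n))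
    (J : set R) :
  open D -> (forall p, D p -> J p.1) -> forall p, D p -> nbhs p.1 J.
Proof.
move=> oD DJ [t x] Dp /=; have := open_nbhs_nbhs (conj oD Dp).
case=> -[P Q] [/= Pt Qx] PQ; apply: filterS Pt => s Ps.
by apply: (DJ (s, x)); apply: PQ; split=> //=; exact: nbhs_singleton.
Qed.

Lemma cont_diff_time_entry (R : realType) (n : nat) (D : set (R * 'cV[R]_n))
    (J : set R) (g : R -> 'M[R]_n) (i j : 'I_n) :
  open D -> (forall p, D p -> J p.1) -> cont_diff_on J g ->
  cont_diff D (fun p => g p.1 i j).
Proof.
move=> oD DJ [g' dg cg]; have Jnbhs := open_projection_nbhs oD DJ.
have dgij p : D p -> is_derive p.1 1 (fun s => g s i j) (g' p.1 i j).
  by move=> Dp; apply: is_derive_on_coord (Jnbhs p Dp) _; apply: dg; exact: DJ.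
apply: (cont_diff_from_derive (dF := fun v p => v.1 * g' p.1 i j)) => //.
- by move=> p /dgij /(derive_comp_fst 0)[].
- by move=> v p /dgij /(derive_comp_fst v)[].
move=> v p Dp; apply: cvgM; first exact: cst_continuous.
(* Continuity within [J] is plain continuity at an interior time. *)
have cg1 : {for p.1, continuous g'}.
  have := cg p.1.
  by rewrite /prop_for /continuous_at /= -nbhs_subspace_interior //; exact: Jnbhs.
apply: (@continuous_comp _ _ _ (fun q => g' q.1) (fun M : 'M[R]_n => M i j)).
  by apply: (@continuous_comp _ _ _ fst g'); [exact: fst_continuous|].
exact: coord_continuous.
Qed.

Lemma cont_diff_row_act (R : realType) (n : nat) (D : set (R * 'cV[R]_n))
    (J : set R) (g : R -> 'M[R]_n) (nu : 'cV[R]_n) :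
  open D -> (forall p, D p -> J p.1) -> cont_diff_on J g ->
  cont_diff D (fun p => row_act nu (g p.1 *m p.2)).
Proof.
move=> oD DJ hg; apply: cont_diff_sum => // i _.
apply: cont_diffM => //; first exact: cont_diff_cst.
under eq_fun do rewrite mxE.
apply: cont_diff_sum => // j _; apply: cont_diffM => //.
- exact: cont_diff_time_entry DJ hg.
- exact: cont_diff_snd_coord.
Qed.

Lemma derive_row_act (R : realType) (n : nat) (J : set R) (g : R -> 'M[R]_n)
    (l : 'M[R]_n) (nu : 'cV[R]_n) (p v : R * 'cV[R]_n) :
  nbhs p.1 J -> is_derive_on J g p.1 l ->
  'D_v (fun q => row_act nu (g q.1 *m q.2)) p =
  row_act nu (v.1 *: (l *m p.2) + g p.1 *m v.2).
Proof.
move=> Jp hl.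
have entry i j : differentiable (fun q : R * 'cV[R]_n => g q.1 i j * q.2 j 0) p /\
    'D_v (fun q : R * 'cV[R]_n => g q.1 i j * q.2 j 0) p =
    v.1 * (l i j * p.2 j 0) + g p.1 i j * v.2 j 0.
  have [dg Dg] := derive_comp_fst v (is_derive_on_coord i j Jp hl).
  have [dx Dx] := snd_coord_derive j p v.
  split; first exact: differentiableM dg dx.
  rewrite (deriveM (diff_derivable dg) (diff_derivable dx)) Dg Dx /GRing.scale /=.
  by ring.
have row i : differentiable (fun q : R * 'cV[R]_n => nu i 0 * (g q.1 *m q.2) i 0) p /\
    'D_v (fun q : R * 'cV[R]_n => nu i 0 * (g q.1 *m q.2) i 0) p =
    nu i 0 * (v.1 *: (l *m p.2) + g p.1 *m v.2) i 0.
  have [dS DS] := @derive_big_sum _ _ _ (index_enum 'I_n) _ p v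
    (fun j _ => (entry i j).1).
  rewrite (_ : (fun q : R * 'cV[R]_n => _) = (fun q : R * 'cV[R]_n => nu i 0) * 
     (fun q : R * 'cV[R]_n => \sum_j g q.1 i j * q.2 j 0)); last first.
    by apply/funext => q; rewrite mxE.
  split; first exact: differentiableM.
  rewrite deriveM //; [|exact: diff_derivable..].
  rewrite derive_cst scaler0 addr0 DS !mxE mulr_sumr -big_split /=.
  by congr (_ * _); apply: eq_bigr => j _; rewrite (entry i j).2.
have [_ ->] := @derive_big_sum _ _ _ (index_enum 'I_n) _ p v (fun i _ => (row i).1).
by apply: eq_bigr => i _; rewrite (row i).2.
Qed.

(** * Regularity and differentiation of the functional system *)

(** Smoothness of [Psi] comes from the system itself: its last term is $\Psi_k u_0$, so $\Psi_k$ is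
    recovered by induction as a quotient by the nonvanishing $u_0$. *)
Lemma binomial_system_cont_diff (R : realType) (n m : nat)
    (D : set (R * 'cV[R]_n)) (u Psi : nat -> R * 'cV[R]_n -> R) :
  open D -> (forall k, (k < m)%N -> cont_diff D (u k)) ->
  (forall p, D p -> u 0%N p != 0) ->
  (forall p, D p -> forall k, (1 <= k < m)%N -> u k p =
     \sum_(1 <= tau < k.+1) 'C(k.-1, tau.-1)%:R * Psi tau p * u (k - tau)%N p) ->
  forall k, (1 <= k < m)%N -> cont_diff D (Psi k).
Proof.
move=> oD cu u0 hPsi k; elim/ltn_ind: k => -[//|k] IH /= km.
pose S p := \sum_(1 <= tau < k.+1) 'C(k, tau.-1)%:R * Psi tau p * u (k.+1 - tau)%N p.
have cS : cont_diff D S.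
  apply: cont_diff_sum => // t; rewrite mem_index_iota => /andP[t1 tk].
  apply: cont_diffM => //; first apply: cont_diffM => //.
  - exact: cont_diff_cst.
  - by apply: IH; rewrite ?ltnS ?t1 ?(ltn_trans tk km) // ltnW.
  - by apply: cu; exact: leq_ltn_trans (leq_subr _ _) km.
have m0 : (0 < m)%N by exact: leq_ltn_trans km.
(* [cQ] will be the solved form $(u_{k+1} - S)/u_0$ of the equation. *)
have cB := cont_diffD oD (cu _ km) (cont_diffM oD (cont_diff_cst D (-1)) cS).
have cQ := cont_diffM oD cB (cont_diffV oD u0 (cu _ m0)).
apply: (cont_diff_eq oD _ cQ) => p Dp.
rewrite !fctE (hPsi p Dp k.+1 km) big_nat_recr //= subnn binn.
by rewrite mul1r mulN1r addrAC subrr add0r mulfK // u0.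
Qed.

Lemma binomial_system_derive (R : realType) (n m : nat)
    (D : set (R * 'cV[R]_n)) (u Psi : nat -> R * 'cV[R]_n -> R) p v :
  open D -> (forall k, (k < m)%N -> cont_diff D (u k)) ->
  (forall k, (1 <= k < m)%N -> cont_diff D (Psi k)) ->
  (forall p, D p -> forall k, (1 <= k < m)%N -> u k p =
     \sum_(1 <= tau < k.+1) 'C(k.-1, tau.-1)%:R * Psi tau p * u (k - tau)%N p) ->
  D p -> forall k, (1 <= k < m)%N -> 'D_v (u k) p =
    \sum_(1 <= tau < k.+1) 'C(k.-1, tau.-1)%:R *
      (Psi tau p * 'D_v (u (k - tau)%N) p + 'D_v (Psi tau) p * u (k - tau)%N p).
Proof.
move=> oD cu cPsi hPsi Dp k k1m.
have -> : 'D_v (u k) p = 'D_v (fun q => \sum_(1 <= tau < k.+1)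
    'C(k.-1, tau.-1)%:R * Psi tau q * u (k - tau)%N q) p.
  apply: near_eq_derive; apply: filterS (open_nbhs_nbhs (conj oD Dp)) => q Dq.
  exact: hPsi.
have term t : t \in index_iota 1 k.+1 ->
    differentiable (fun q => 'C(k.-1, t.-1)%:R * Psi t q * u (k - t)%N q) p /\
    'D_v (fun q => 'C(k.-1, t.-1)%:R * Psi t q * u (k - t)%N q) p =
    'C(k.-1, t.-1)%:R *
      (Psi t p * 'D_v (u (k - t)%N) p + 'D_v (Psi t) p * u (k - t)%N p).
  rewrite mem_index_iota => /andP[t1 tk]; have [k1 km] := andP k1m.
  have [dP _] : cont_diff D (Psi t).
    by apply: cPsi; rewrite t1 (leq_ltn_trans _ km).
  have [du _] : cont_diff D (u (k - t)%N).
    by apply: cu; exact: leq_ltn_trans (leq_subr _ _) km.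
  have dc := differentiable_cst ('C(k.-1, t.-1)%:R : R) p.
  have dcP := differentiableM dc (dP p Dp).
  split; first exact: differentiableM dcP (du p Dp).
  rewrite (deriveM (diff_derivable dcP) (diff_derivable (du p Dp))).
  rewrite (deriveM (diff_derivable dc) (diff_derivable (dP p Dp))) derive_cst.
  by rewrite /GRing.scale /= !fctE; ring.
have [_ ->] := derive_big_sum v (fun t tr => (term t tr).1).
by apply: eq_big_seq => t tr; rewrite (term t tr).2.
Qed.

Lemma derive_partials (R : realType) (n : nat) (F : R * 'cV[R]_n -> R)
    (p : R * 'cV[R]_n) (s : R) (z : 'cV[R]_n) :
  differentiable F p ->
  'D_(s, z) F p = s * partial_t F p + \sum_(i < n) z i 0 * partial_x i F p.
Proof.
move=> dF; rewrite /partial_t /partial_x deriveE //.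
have -> : (s, z) = s *: ((1 : R), (0 : 'cV[R]_n)) +
    \sum_(i < n) z i 0 *: ((0 : R), (delta_mx i 0 : 'cV[R]_n)).
  have -> : \sum_(i < n) z i 0 *: ((0 : R), (delta_mx i 0 : 'cV[R]_n)) = (0, z).
    transitivity (\sum_(i < n) ((0 : R), (z i 0 *: delta_mx i 0 : 'cV[R]_n))).
      by apply: eq_bigr => i _; congr pair; rewrite /= scaler0.
    rewrite [in RHS](matrix_sum_delta z); apply/esym.
    under [in LHS]eq_bigr do rewrite big_ord1.
    (* The two sums are built in parallel: pairing with a zero first component is additive. *)
    elim/big_rec2: _ => // i a b _ <-.
    by congr pair; rewrite /= addr0.
  by congr pair; rewrite /= ?addr0 ?scaler0 ?add0r // /GRing.scale /= mulr1.
rewrite linearD linearZ linear_sum /= deriveE //; congr (_ + _).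
by apply: eq_bigr => i _; rewrite linearZ /= deriveE.
Qed.

Lemma row_actE (R : realType) (n : nat) (nu y : 'cV[R]_n) :
  row_act nu y = (nu^T *m y) 0 0.
Proof. by rewrite mxE; apply: eq_bigr => i _; rewrite mxE. Qed.

(** * First integrals and their independence *)

Theorem theorem3p4 (R : realType) (n m : nat) (J : set R)
    (A : R -> 'M[R]_n) (G : set (R -> 'M[R]_n)) (g : R -> 'M[R]_n)
    (B C : 'M[R]_n) (lam : R) (nu : nat -> 'cV[R]_n)
    (Lam : set (R * 'cV[R]_n)) (Psi : nat -> R * 'cV[R]_n -> R)
    (hJ : is_interval J)
    (hA : {within J, continuous A})
    (hG : matrix_fun_group J G)
    (hg : G g)
    (hred : reduces J A B g)
    (hC : C = B^T)
    (hm : (2 <= m)%N)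
    (hdiv : elementary_divisor C lam m)
    (hnu0 : nu 0%N != 0 /\ C *m nu 0%N = lam *: nu 0%N)
    (hnu : forall k : nat, (1 <= k < m)%N ->
       nu k != 0 /\ (C - lam%:M) *m nu k = k%:R *: nu k.-1)
    (hLam : is_domain Lam)
    (hLamsub : Lam `<=`
       [set p | J p.1 /\ row_act (nu 0%N) (g p.1 *m p.2) != 0])
    (hPsi : forall t x, Lam (t, x) -> forall k : nat, (1 <= k < m)%N ->
       row_act (nu k) (g t *m x) =
       \sum_(1 <= tau < k.+1)
         'C(k.-1, tau.-1)%:R * Psi tau (t, x)
           * row_act (nu (k - tau)%N) (g t *m x)) :
  (forall xi : nat, (2 <= xi < m)%N ->
     first_integral (fun t x => A t *m x) Lam (Psi xi)) /\
  functionally_independent Lam (fun i : 'I_(m - 2) => Psi (i + 2)%N).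
Proof.
have oL : open Lam by case: hLam.
have LJ p : Lam p -> J p.1 by case/hLamsub.
have Jnbhs := open_projection_nbhs oL LJ.
have [/(_ g hg)[cdg gunit] _ _ _] := hG.
have [_ dg] := hred; have [nu00 Cnu0] := hnu0.
have hchain k : (1 <= k < m)%N -> (C - lam%:M) *m nu k = k%:R *: nu k.-1.
  by case/hnu.
pose u k (p : R * 'cV[R]_n) := row_act (nu k) (g p.1 *m p.2).
have cu k : (k < m)%N -> cont_diff Lam (u k).
  by move=> _; exact: cont_diff_row_act LJ cdg.
have u0 p : Lam p -> u 0%N p != 0 by case/hLamsub.
have system p : Lam p -> forall k, (1 <= k < m)%N -> u k p =
    \sum_(1 <= tau < k.+1) 'C(k.-1, tau.-1)%:R * Psi tau p * u (k - tau)%N p.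
  by case: p => t x; exact: hPsi.
have cPsi := binomial_system_cont_diff oL cu u0 system.
have leibniz p v (Lp : Lam p) := binomial_system_derive v oL cu cPsi system Lp.
have du k p v : Lam p -> 'D_v (u k) p = row_act (nu k)
    (v.1 *: ((B *m g p.1 - g p.1 *m A p.1) *m p.2) + g p.1 *m v.2).
  by move=> Lp; apply: derive_row_act (Jnbhs p Lp) (dg p.1 (LJ p Lp)).
split.
  move=> k /andP[k2 km]; have k1m : (1 <= k < m)%N by rewrite (ltnW k2).
  have [dPsi _] := cPsi k k1m.
  split=> [|t x Lp]; first exact: cPsi.
  (* Along the flow the terms with [g t *m A t] cancel, leaving $\nu^i B\,\mathrm g(t)x$, and
     transposition turns $\nu^i B$ into $C\nu^i$. For [i = 0] the zero coefficient makes [i.-1]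
     harmless. *)
  have flow i : (i < m)%N -> 'D_(1, A t *m x) (u i) (t, x) =
      lam * u i (t, x) + i%:R * u i.-1 (t, x).
    move=> im; rewrite du //= scale1r mulmxBl -mulmxA (mulmxA (g t)) subrK.
    have Cnu : C *m nu i = lam *: nu i + i%:R *: nu i.-1.
      case: i im => [|i] im; first by rewrite scale0r addr0.
      by rewrite -hchain // mulmxBl mul_scalar_mx addrC subrK.
    have nuB : (nu i)^T *m B = (C *m nu i)^T by rewrite trmx_mul hC trmxK.
    rewrite /u !row_actE (mulmxA _ B) nuB Cnu.
    by rewrite linearD !linearZ /= mulmxDl -!scalemxAl !mxE.
  have := derivation_values (u0 _ Lp) flow (system _ Lp) (leibniz _ _ Lp) k1m.
  rewrite derive_partials; last exact: dPsi.
  by rewrite mul1r gtn_eqF.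
case=> t x Lp; set JF := jacobian_tx _ _.
pose N := \matrix_(k < m) (nu k)^T.
have Nfree : row_free N by exact: chain_row_free nu00 Cnu0 hchain.
(* The rows of [N] are independent and [g t] is invertible, whence the right inverse [Z]. *)
have /row_freeP[Z NgZ] : row_free (N *m g t).
  by rewrite /row_free mxrankMfree ?row_free_unit ?gunit //; exact: LJ Lp.
have im2 (i : 'I_(m - 2)) : (i + 2 < m)%N by rewrite addnC -ltn_subRL.
(* The functions start at $\Psi_2$, so the columns of [Z] dual to $u_0$ and $u_1$ are skipped. *)
pose sh i := Ordinal (im2 i).
pose z (j : 'I_(m - 2)) := col (sh j) Z.
have duz k j : (k < m)%N -> 'D_(0, z j) (u k) (t, x) = (k == j + 2)%N%:R.
  move=> km; rewrite du //= scale0r add0r row_actE.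
  have <- : (N *m g t *m Z) (Ordinal km) (sh j) = (k == j + 2)%N%:R.
    by rewrite NgZ mxE.
  have -> : (nu k)^T = row (Ordinal km) N by rewrite rowK.
  by rewrite /z colE !mulmxA -!row_mul -colE !mxE.
(* The zero top row makes the directions purely spatial; [JF *m Zs] then collects the derivatives of
   the [Psi] along [(0, z j)]. *)
pose Zs : 'M[R]_(1 + n, m - 2) := col_mx 0 (\matrix_(i, j) z j i 0).
have JZE i j : (JF *m Zs) i j = 'D_(0, z j) (Psi (i + 2)%N) (t, x).
  have i1m : (1 <= i + 2 < m)%N by rewrite im2 addn2.
  rewrite /JF /jacobian_tx mul_row_col mulmx0 add0r mxE.
  rewrite derive_partials; last by case: (cPsi _ i1m) => + _; apply.
  by rewrite mul0r add0r; apply: eq_bigr => l _; rewrite !mxE mulrC.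
(* Entries on and above the diagonal suffice: they show a lower triangular matrix with diagonal
   $1/u_0$. *)
have tri (i j : 'I_(m - 2)) : (i <= j)%N ->
    (JF *m Zs) i j = (i == j)%:R / u 0%N (t, x).
  move=> ij; rewrite JZE.
  rewrite (@triangular_values _ m (j + 2) (fun k => u k (t, x))
    (fun k => 'D_(0, z j) (u k) (t, x)) (fun k => Psi k (t, x))
    (fun k => 'D_(0, z j) (Psi k) (t, x))) ?leq_add2r ?eqn_add2r //.
  - exact: u0.
  - by rewrite addn2.
  - by move=> k kj; rewrite duz ?ltn_eqF // (ltn_trans kj).
  - by rewrite duz ?eqxx.
  - by move=> k km; rewrite (leibniz _ (0, z j) Lp k km).
  - by rewrite im2 addn2.
have JZunit : JF *m Zs \in unitmx.
  rewrite unitmxE det_trig.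
    rewrite unitfE; apply/prodf_neq0 => i _.
    by rewrite tri // eqxx mul1r invr_eq0 u0.
  apply/is_trig_mxP => i j ij; rewrite tri ?(ltnW ij) //.
  by rewrite -val_eqE /= ltn_eqF // mul0r.
(* Full rank of [JF] follows from a right inverse, obtained from the invertible product
   [JF *m Zs]. *)
apply/eqP; change (row_free JF); apply/row_freeP.
by exists (Zs *m invmx (JF *m Zs)); rewrite mulmxA mulmxV.
Qed.
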